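(* For $n\ge1$ let $\beta_n=\sigma_1^{-n}$, a braid word on $2$ strands, and let $f(n)$ be the number of simple walks on $\beta_n$ (with $J\subseteq\{2\}$, i.e. $J=\{2\}$). Then $$f(n)=\left(\frac{5+\sqrt5}{10}\right)\left(\frac{1+\sqrt5}{2}\right)^n+\left(\frac{5-\sqrt5}{10}\right)\left(\frac{1-\sqrt5}{2}\right)^n .$$
   Context: Braid words. A braid word on $m$ strands is an expression $\beta=\sigma_{i_1}^{\varepsilon_1}\cdots\sigma_{i_\ell}^{\varepsilon_\ell}$ with $1\le i_k\le m-1$ and $\varepsilon_k=\pm1$. It is read left to right and drawn top to bottom, so crossing $1$ is at the top and crossing $\ell$ at the bottom. Strand positions are numbered $1,\dots,m$ from left to right. In $\sigma_i$ the $(i+1)$-st strand crosses over the $i$-th strand; in $\sigma_i^{-1}$ the $i$-th strand crosses over the $(i+1)$-st. Paths. A path on $\beta$ goes from the bottom of the braid to the top. On meeting a crossing along the understrand it must stay on the understrand; on meeting it along the overstrand it either stays on the overstrand or ''jumps down'' to the understrand and continues upward. Explicitly, a path is a sequence of positions $(p_\ell,p_{\ell-1},\dots,p_0)$, where $p_\ell$ is the position at the bottom, $p_0$ the position at the top, and the step $p_k\to p_{k-1}$ through crossing $k$ (with $i=i_k$) is as follows: if $p_k\notin\{i,i+1\}$ then $p_{k-1}=p_k$; if $\varepsilon_k=+1$, then $i\to i+1$ (overstrand), $i\to i$ (jump down), $i+1\to i$ (understrand) are the allowed steps; if $\varepsilon_k=-1$, then $i+1\to i$ (overstrand), $i+1\to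 i+1$ (jump down), $i\to i+1$ (understrand) are the allowed steps. Walks. A walk $W$ on $\beta$ consists of a nonempty set $J\subseteq\{1,\dots,m\}$, a permutation $\pi$ of $J$, and exactly one path from $j$ (at the bottom) to $\pi(j)$ (at the top) for each $j\in J$. The walk is simple if no two of its paths intersect, i.e. at each level between consecutive crossings (and at top and bottom) its paths occupy distinct positions (one path may cross over another at a crossing). The simple walks being counted are always those with $J\subseteq\{2,\dots,m\}$. *)

(* Defs.v *)
From HB Require Import structures.
From mathcomp Require Import all_boot all_order all_fingroup all_algebra.
Set Implicit Arguments.
Unset Strict Implicit.
Unset Printing Implicit Defensive.

(** Positions and generators are numbered from 0: [j : 'I_m] stands for the
    strand position j+1, and [(i, e) : crossing m] for the generator
    sigma_{i+1} if [e = true], and for its inverse if [e = false].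
    The head of a braid word is its top crossing. *)
Definition crossing (m : nat) := ('I_m.-1 * bool)%type.
Definition braid_word (m : nat) := seq (crossing m).

(** [step c p q]: a path below the crossing [c] at position [p] may be at
    position [q] above it. The positions of the two strands meeting in [c]
    are [i] and [i.+1]. *)
Definition step (m : nat) (c : crossing m) (p q : 'I_m) : bool :=
  let i : nat := c.1 in
  if c.2 then
    if p == i :> nat then (q == i.+1 :> nat) (* overstrand *)
                          || (q == i :> nat) (* jump down *)
    else if p == i.+1 :> nat then q == i :> nat (* understrand *)
    else q == p
  else
    if p == i.+1 :> nat then (q == i :> nat) (* overstrand *)
                             || (q == i.+1 :> nat) (* jump down *)
    else if p == i :> nat then q == i.+1 :> nat (* understrand *)
    else q == p.

Section Walks.

Variables (m : nat) (b : braid_word m).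

(** The levels are 0 (top), ..., [size b] (bottom); the crossing with index
    [k : 'I_(size b)] lies between the level [k] above it and the level
    [k.+1] below it. *)
Definition level := 'I_(size b).+1.

Definition is_path (p : {ffun level -> 'I_m}) : bool :=
  [forall k : 'I_(size b),
     step (tnth (in_tuple b) k) (p (lift ord0 k)) (p (widen_ord (leqnSn _) k))].

Definition bpath := {p : {ffun level -> 'I_m} | is_path p}.

Definition position_at (p : bpath) (k : level) : 'I_m := val p k.
Definition bottom (p : bpath) : 'I_m := position_at p ord_max.
Definition top (p : bpath) : 'I_m := position_at p ord0.

(** A set [J] of positions, a permutation of [J], and one path for each
    element of [J]. *)
Definition walk_data :=
  {J : {set 'I_m} & ({perm {j | j \in J}} * {ffun {j | j \in J} -> bpath})%type}.

Definition is_walk (W : walk_data) : bool :=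
  let: existT J (pi, P) := W in
  (J != set0) &&
  [forall j : {j | j \in J}, (bottom (P j) == val j) && (top (P j) == val (pi j))].

Definition walk := {W : walk_data | is_walk W}.

Definition walk_support (W : walk) : {set 'I_m} := tag (val W).

Definition walk_path (W : walk) : {j | j \in walk_support W} -> bpath :=
  (tagged (val W)).2.

Definition simple_walk (W : walk) : bool :=
  [forall k : level,
     injectiveb (fun j : {j | j \in walk_support W} =>
                   position_at (walk_path j) k)].

(** [0 < j] is the condition that the position is at least 2 in the numbering
    from 1. *)
Definition num_simple_walks : nat :=
  #|[set W : walk | simple_walk W &
       walk_support W \subset [set j : 'I_m | 0 < j]]|.

End Walks.

Definition beta (n : nat) : braid_word 2 := nseq n (ord0, false).

Definition f (n : nat) : nat := num_simple_walks (beta n).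

(* Main.v *)
Require Import Defs.
From HB Require Import structures.
From mathcomp Require Import all_boot all_order all_fingroup all_algebra ring.
Set Implicit Arguments.
Unset Strict Implicit.
Unset Printing Implicit Defensive.
Import Order.TTheory GRing.Theory Num.Theory.
Local Open Scope ring_scope.

(** A simple walk supported on position 2 alone is a single path from position 2
    to itself. Paths are counted by the transfer matrices of the crossings, and
    that of [sigma_1^-1] is the Fibonacci matrix, so [f n] is the Fibonacci number
    F_(n+1); the formula is Binet's. *)

(** The entry at bottom [x] and top [y] of the product of the transfer matrices of the crossings of
    [b]. *)
Definition num_paths (m : nat) (b : braid_word m) (x y : 'I_m) : nat :=
  #|[set p : {ffun level b -> 'I_m} |
      [&& is_path p, p ord_max == x & p ord0 == y]]|.

Section TransferMatrix.

Variables (m : nat) (c : crossing m) (b : braid_word m).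

(** The head of the word is the top crossing, so the new level is level 0 and each level of [q]
    moves down by one. *)
Definition path_cons (y : 'I_m) (q : {ffun level b -> 'I_m}) :
    {ffun level (c :: b) -> 'I_m} :=
  [ffun k => if unlift ord0 k is Some j then q j else y].

Lemma path_cons0 y q : path_cons y q ord0 = y.
Proof. by rewrite ffunE unlift_none. Qed.

Lemma path_consS y q (k : level b) : path_cons y q (lift ord0 k) = q k.
Proof. by rewrite ffunE liftK. Qed.

Lemma path_cons_max y q : path_cons y q ord_max = q ord_max.
Proof. by rewrite -(path_consS y); congr (path_cons y q _); apply: val_inj. Qed.

Lemma is_path_cons y q :
  is_path (path_cons y q) = step c (q ord0) y && is_path q.
Proof.
apply/forallP/andP => [h | [h0 /forallP h] k].
  split.
    have := h ord0.
    rewrite (tnth_nth c) /= path_consS.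
    by rewrite [widen_ord _ _](_ : _ = ord0) ?path_cons0 //; apply: val_inj.
  apply/forallP => k; have := h (lift ord0 k).
  rewrite !(tnth_nth c) /= path_consS.
  (* The level above the shifted crossing is the shift of the level above crossing [k] in [b]. *)
  rewrite [widen_ord _ (lift _ _)](_ : _ = lift ord0 (widen_ord (leqnSn _) k)).
    by rewrite path_consS.
  exact: val_inj.
case: (unliftP ord0 k) => [j|] ->.
  have := h j; rewrite !(tnth_nth c) /= path_consS.
  rewrite [widen_ord _ (lift _ _)](_ : _ = lift ord0 (widen_ord (leqnSn _) j)).
    by rewrite path_consS.
  exact: val_inj.
rewrite (tnth_nth c) /= path_consS.
by rewrite [widen_ord _ _](_ : _ = ord0) ?path_cons0 //; apply: val_inj.
Qed.

Lemma path_cons_inj y : injective (path_cons y).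
Proof.
move=> q q' /ffunP e; apply/ffunP => k.
by have := e (lift ord0 k); rewrite !path_consS.
Qed.

Lemma path_consK (p : {ffun level (c :: b) -> 'I_m}) :
  path_cons (p ord0) [ffun k => p (lift ord0 k)] = p.
Proof.
apply/ffunP => k; case: (unliftP ord0 k) => [j|] ->.
  by rewrite path_consS ffunE.
by rewrite path_cons0.
Qed.

(** Matrix multiplication: once the top [y] is fixed, a path is determined by its part below [c],
    and these parts are sorted by the position [z] just below [c]. *)
Lemma num_paths_cons x y :
  num_paths (c :: b) x y = (\sum_z step c z y * num_paths b x z)%N.
Proof.
pose A := [set q : {ffun level b -> 'I_m} |
  [&& step c (q ord0) y, is_path q & q ord_max == x]].
have -> : num_paths (c :: b) x y = #|A|.
  rewrite -(card_imset _ (@path_cons_inj y)) /num_paths.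
  congr #|pred_of_set _|; apply/setP => p; rewrite inE.
  apply/and3P/imsetP => [[hp hx /eqP hy] | [q]]; last first.
    rewrite inE => /and3P[h1 h2 h3] ->.
    by rewrite is_path_cons path_cons_max path_cons0 h1 h2 h3.
  exists [ffun k => p (lift ord0 k)]; last by rewrite -hy path_consK.
  have := path_consK p; rewrite hy => e; rewrite inE andbA.
  by rewrite -is_path_cons e hp -(path_cons_max y) e.
rewrite -sum1_card (partition_big (fun q : {ffun _ -> _} => q ord0) predT) //=.
apply: eq_bigr => z _; rewrite sum1_card /num_paths -cardsE.
case hz: (step c z y).
  rewrite mul1n; congr #|pred_of_set _|; apply/setP => q; rewrite !inE unfold_in inE.
  by case: (q ord0 =P z) => [->|_]; rewrite ?hz ?andbT ?andbF ?andbA.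
rewrite mul0n; apply/eqP; rewrite cards_eq0; apply/eqP/setP => q; rewrite !inE unfold_in inE.
by case: (q ord0 =P z) => [->|_]; rewrite ?hz ?andbF.
Qed.

End TransferMatrix.

Lemma num_paths_nil (m : nat) (x y : 'I_m) : num_paths [::] x y = (x == y).
Proof.
(* The empty word has a single level, which is both top and bottom. *)
have e (p : {ffun level ([::] : braid_word m) -> 'I_m}) k : p k = p ord0.
  by rewrite [k]ord1.
rewrite /num_paths; case: eqVneq => [->|nxy].
  apply/eqP/cards1P; exists [ffun => y]; apply/setP => p; rewrite !inE e andbb.
  apply/andP/eqP => [[_ /eqP h]|->].
    by apply/ffunP => k; rewrite e ffunE.
  by rewrite ffunE eqxx; split=> //; apply/forallP => -[].
apply/eqP; rewrite cards_eq0; apply/eqP/setP => p; rewrite !inE e.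
apply/negP => /and3P[_ /eqP hx /eqP hy].
by rewrite -hx -hy eqxx in nxy.
Qed.

Section SingletonSupport.

Variables (m : nat) (b : braid_word m) (x : 'I_m).

Definition closed_walk (p : bpath b) : walk_data b :=
  existT _ [set x] (1%g, [ffun => p]).

Lemma closed_walk_inj : injective closed_walk.
Proof.
(* The paths of a walk are indexed by its own support; collecting them into a set gives an invariant
   of a fixed type, which recovers [p]. *)
pose paths (W : walk_data b) : {set bpath b} := [set (tagged W).2 j | j in predT].
have pathsE p : paths (closed_walk p) = [set p].
  apply/setP => q; rewrite inE; apply/imsetP/eqP => [[j _ ->]|->].
    by rewrite ffunE.
  by exists (Sub x (set11 x)) => //; rewrite ffunE.
by move=> p q e; apply: set1_inj; rewrite -!pathsE e.
Qed.

(** A nonempty subset of [[set x]] is all of it, its only permutation is the identity, and a single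
    path meets no other, so [closed_walk] is a bijection onto these walks. *)
Lemma card_simple_walks_set1 :
  #|[set W : walk b | simple_walk W & walk_support W \subset [set x]]| =
  num_paths b x x.
Proof.
pose A := [set p : bpath b | (bottom p == x) && (top p == x)].
have -> : num_paths b x x = #|A|.
  rewrite -(card_imset _ val_inj) /num_paths.
  congr #|pred_of_set _|; apply/setP => p; rewrite inE.
  apply/and3P/imsetP => [[hp hx hy] | [q]].
    by exists (Sub p hp) => //; rewrite inE; apply/andP.
  by rewrite inE => /andP[hx hy] ->; split=> //; apply: valP.
(* Both sets are compared through their images in [walk_data b]. *)
rewrite -(card_imset _ val_inj) -(card_imset A closed_walk_inj).
congr #|pred_of_set _|; apply/setP => W; apply/imsetP/imsetP => [[V] | [p]].
  rewrite inE => /andP[_]; rewrite /walk_support.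
  case: V => -[J [pi P]] /= /andP[J0 /forallP hV].
  rewrite subset1 (negbTE J0) orbF => /eqP eJ ->; subst J.
  pose j0 : {j | j \in [set x]} := Sub x (set11 x).
  have j0P j : j = j0 by apply: val_inj; apply/set1P; apply: valP.
  exists (P j0).
    by have := hV j0; rewrite inE (j0P (pi j0)).
  have -> : pi = 1%g by apply/permP => j; rewrite (j0P (pi j)) perm1 -(j0P j).
  by have {1}-> : P = [ffun => P j0] by apply/ffunP => j; rewrite ffunE (j0P j).
rewrite inE => /andP[hb ht] ->.
have hW : is_walk (closed_walk p).
  rewrite /is_walk /=; apply/andP; split.
    by apply/set0Pn; exists x; rewrite set11.
  apply/forallP => j; rewrite ffunE perm1.
  by have /set1P -> := valP j; rewrite hb.
exists (Sub (closed_walk p) hW) => //.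
rewrite inE /walk_support /= subxx andbT.
apply/forallP => k; apply/injectiveP => i j _; apply: val_inj.
by have /set1P -> := valP i; have /set1P -> := valP j.
Qed.

End SingletonSupport.

Lemma f_num_paths (n : nat) : f n = num_paths (beta n) ord_max ord_max.
Proof.
rewrite -card_simple_walks_set1 /f /num_simple_walks.
suff -> : [set j : 'I_2 | 0 < j]%N = [set ord_max] by [].
by apply/setP => -[[|[|k]] ltk2]; rewrite !inE.
Qed.

(** The right position above the crossing is reached from the left along the understrand and from
    the right by jumping down. *)
Lemma num_pathsSr (n : nat) (x : 'I_2) :
  num_paths (beta n.+1) x ord_max =
  (num_paths (beta n) x ord0 + num_paths (beta n) x ord_max)%N.
Proof.
rewrite num_paths_cons big_ord_recl big_ord1 /= !mul1n.
by congr (_ + num_paths _ _ _)%N; apply: val_inj.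
Qed.

(** Only the overstrand, coming from the right, leads to the left position. *)
Lemma num_pathsSl (n : nat) (x : 'I_2) :
  num_paths (beta n.+1) x ord0 = num_paths (beta n) x ord_max.
Proof.
rewrite num_paths_cons big_ord_recl big_ord1 /= mul0n mul1n add0n.
by congr (num_paths _ _ _); apply: val_inj.
Qed.

(** The two recurrences are coupled, so F_n and F_(n+1) are treated in one induction. Here [s / 5]
    is 1/sqrt 5, and [(5 + s) / 10] is the golden ratio divided by sqrt 5. *)
Lemma num_paths_binet (R : rcfType) (n : nat) :
  let s : R := Num.sqrt 5 in
  (num_paths (beta n) ord_max ord0)%:R =
    s / 5 * (((1 + s) / 2) ^+ n - ((1 - s) / 2) ^+ n) /\
  (num_paths (beta n) ord_max ord_max)%:R =
    (5 + s) / 10 * ((1 + s) / 2) ^+ n + (5 - s) / 10 * ((1 - s) / 2) ^+ n.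
Proof.
move=> s; have s2 : s ^+ 2 = 5 by rewrite sqr_sqrtr ?ler0n.
elim: n => [|n [IH0 IH1]].
  by rewrite !num_paths_nil /= !expr0; split; field.
rewrite num_pathsSl num_pathsSr natrD IH0 IH1 !exprS.
by split; field: s2.
Qed.

Theorem proposition6p1 (R : rcfType) (n : nat) (hn : (1 <= n)%N) :
  (f n)%:R =
    (5 + Num.sqrt 5) / 10 * ((1 + Num.sqrt 5) / 2) ^+ n
    + (5 - Num.sqrt 5) / 10 * ((1 - Num.sqrt 5) / 2) ^+ n :> R.
Proof. by rewrite f_num_paths; case: (num_paths_binet R n). Qed.
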